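(* Let $\tilde P$ be the pseudo-marginal kernel with weight distributions $\{Q_x\}_{x\in\mathsf X}$ and let $\bar P$ be the auxiliary kernel $$\bar P(x,w;\mathrm dy,\mathrm du)=q(x,\mathrm dy)\pi_y(\mathrm du)\min\{1,r(x,y)\}+\delta_{x,w}(\mathrm dy,\mathrm du)\rho(x).$$ Suppose there exists a constant $\bar w\in[1,\infty)$ such that $Q_x([0,\bar w])=1$ for $\pi$-almost every $x\in\mathsf X$. Then the Dirichlet form of the pseudo-marginal algorithm satisfies $$\mathcal E_{\tilde P}(f)\ge\bar w^{-1}\mathcal E_{\bar P}(f)$$ for any function $f:\mathsf X\times\mathsf W\to\mathbb R$ with $\tilde\pi(f^2)<\infty$, implying $\operatorname{Gap}(\tilde P)\ge\bar w^{-1}\operatorname{Gap}(\bar P)$.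
   Context: Let $(\mathsf X,\mathcal B(\mathsf X))$ be a measurable space, $\pi$ a probability measure on it and $q(x,\mathrm dy)$ a Markov kernel on $\mathsf X$. The function $r(x,y)=\frac{\pi(\mathrm dy)q(y,\mathrm dx)}{\pi(\mathrm dx)q(x,\mathrm dy)}$ is the Radon--Nikodym derivative in the sense of Tierney: there is a symmetric measurable set $R\subset\mathsf X^2$ on which the measures $\pi(\mathrm dx)q(x,\mathrm dy)$ and $\pi(\mathrm dy)q(y,\mathrm dx)$ are mutually absolutely continuous, and on whose complement they are mutually singular; on $R$, $r$ is the density of the second with respect to the first, with values in $(0,\infty)$ and $r(x,y)r(y,x)=1$; off $R$, $r:=0$. Put $\rho(x)=1-\int\min\{1,r(x,y)\}q(x,\mathrm dy)$. Let $\mathsf W$ be a Borel subset of $\mathbb R_+=[0,\infty)$ and let $x\mapsto Q_x$ be a probability kernel from $\mathsf X$ to $\mathsf W$ with $\int w\,Q_x(\mathrm dw)=1$ for all $x$. Put $\pi_x(\mathrm dw)=w\,Q_x(\mathrm dw)$ and $\tilde\pi(\mathrm dx,\mathrm dw)=\pi(\mathrm dx)\pi_x(\mathrm dw)$. The pseudo-marginal kernel is $\tilde P(x,w;\mathrm dy,\mathrm du)=\min\{1,r(x,y)\frac uw\}q(x,\mathrm dy)Q_y(\mathrm du)+\delta_{x,w}(\mathrm dy,\mathrm du)\tilde\rho(x,w)$ with $\tilde\rho(x,w)=1-\iint\min\{1,r(x,y)\frac uw\}q(x,\mathrm dy)Q_y(\mathrm du)$. (If $0\in\mathsf W$, read $\min\{1,r(x,y)u/w\}$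 as $1$ for $w=0$; the set $\{w=0\}$ is $\tilde\pi$-null.) Both $\tilde P$ and $\bar P$ are reversible with respect to $\tilde\pi$. For a Markov kernel $\Pi$ reversible with respect to a probability $\mu$ and $g$ with $\mu(g^2)<\infty$, the Dirichlet form is $\mathcal E_\Pi(g)=\langle g,(I-\Pi)g\rangle_\mu=\frac12\int\mu(\mathrm dx)\Pi(x,\mathrm dy)[g(x)-g(y)]^2$, and the (right) spectral gap is $\operatorname{Gap}(\Pi)=\inf\{\mathcal E_\Pi(g)/\operatorname{var}_\mu(g):\operatorname{var}_\mu(g)>0\}$, with $\operatorname{var}_\mu(g)=\mu((g-\mu(g))^2)$. *)

(* Defs.v *)
(* MathComp-Analysis development over an abstract [R : realType]. *)
From HB Require Import structures.
From mathcomp Require Import all_boot all_order all_algebra.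
From mathcomp Require Import all_classical all_reals all_analysis.
From mathcomp Require Import measurable_realfun.

Set Implicit Arguments.
Unset Strict Implicit.
Unset Printing Implicit Defensive.
Import Order.TTheory GRing.Theory Num.Theory.
Import numFieldNormedType.Exports.

Local Open Scope classical_set_scope.
Local Open Scope ring_scope.

(* The measure m(dx) k(x, dy) on the product space. *)
Section semidirect_product.
Local Open Scope ereal_scope.
Context d d' (X : measurableType d) (Y : measurableType d') (R : realType).

Definition semiprod (m : {measure set X -> \bar R})
    (k : X -> {measure set Y -> \bar R}) (A : set (X * Y)) : \bar R :=
  \int[m]_x k x (xsection A x).

Section measure.
Variables (m : {measure set X -> \bar R}) (k : R.-fker X ~> Y).

Let semiprod0 : semiprod m k set0 = 0.
Proof. by apply: integral0_eq => x _; rewrite xsection0 measure0. Qed.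

Let semiprod_ge0 A : 0 <= semiprod m k A.
Proof. exact: integral_ge0. Qed.

Let semiprod_sigma_additive : semi_sigma_additive (semiprod m k).
Proof.
move=> F mF tF mUF.
rewrite (_ : semiprod m k (\bigcup_n F n) =
    \sum_(n <oo) semiprod m k (F n)).
  by apply: is_cvg_ereal_nneg_natsum_cond => n _ _; exact: semiprod_ge0.
rewrite /semiprod -integral_nneseries//; last first.
  move=> n; apply: measurable_fun_xsection_finite_kernel.
  by apply/mem_set; exact: mF.
apply: eq_integral => x _; rewrite xsection_bigcup.
apply/esym/cvg_lim => //.
apply: measure_semi_sigma_additive.
- by move=> n; exact: measurable_xsection.
- exact: trivIset_xsection.
- by apply: bigcupT_measurable => n; exact: measurable_xsection.
Qed.

HB.instance Definition _ := isMeasure.Build _ _ _ (semiprod m k)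
  semiprod0 semiprod_ge0 semiprod_sigma_additive.

End measure.

Section probability.
Variables (m : probability X R) (k : R.-pker X ~> Y).

Let semiprod_setT : semiprod m k setT = 1.
Proof.
rewrite /semiprod (eq_integral (cst 1)).
  by rewrite integral_cst// mul1e; exact: probability_setT.
move=> x _; rewrite (_ : xsection _ _ = setT) ?prob_kernel//.
by apply/seteqP; split => // y _; rewrite /xsection/= inE.
Qed.

HB.instance Definition _ :=
  Measure_isProbability.Build _ _ _ (semiprod m k) semiprod_setT.

End probability.

End semidirect_product.

(* The ratio pi(dy)q(y,dx) / pi(dx)q(x,dy) in the sense of Tierney; tierney_set
   is the symmetric set on which the two measures are equivalent, and off which
   they are mutually singular. *)
Section tierney.
Context d (X : measurableType d) (R : realType).
Variables (pi : probability X R) (q : R.-pker X ~> X).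

Local Notation fwd := (semiprod pi q).
Local Notation bwd := (pushforward fwd (fun z : X * X => (z.2, z.1))).

Record tierneyRatio := TierneyRatio {
  tierney_ratio :> X * X -> R ;
  tierney_set : set (X * X) ;
  measurable_tierney_ratio : measurable_fun setT tierney_ratio ;
  measurable_tierney_set : measurable tierney_set ;
  tierney_set_sym : forall x y, tierney_set (x, y) -> tierney_set (y, x) ;
  tierney_fwd_bwd :
    mrestr fwd measurable_tierney_set `<< mrestr bwd measurable_tierney_set ;
  tierney_bwd_fwd :
    mrestr bwd measurable_tierney_set `<< mrestr fwd measurable_tierney_set ;
  tierney_singular : exists2 N, measurable N &
    fwd (~` tierney_set `&` N) = 0%E /\ bwd (~` tierney_set `&` ~` N) = 0%E ;
  tierney_density : forall A, measurable A ->
    bwd (A `&` tierney_set) =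
    (\int[fwd]_(z in A `&` tierney_set) (tierney_ratio z)%:E)%E ;
  tierney_gt0 : forall z, tierney_set z -> 0 < tierney_ratio z ;
  tierney_inv : forall x y, tierney_set (x, y) ->
    tierney_ratio (x, y) * tierney_ratio (y, x) = 1 ;
  tierney_out : forall z, ~ tierney_set z -> tierney_ratio z = 0 }.

Lemma tierney_ge0 (r : tierneyRatio) z : 0 <= r z.
Proof.
have [/tierney_gt0/ltW//|/tierney_out->//] := pselect (tierney_set r z).
Qed.

End tierney.

(* Nonemptiness is automatic for a set carrying a probability; it is recorded
   because measurable types are pointed. *)
Record weightSet (R : realType) := WeightSet {
  weight_set :> set R ;
  measurable_weight_set : measurable weight_set ;
  weight_set_ge0 : weight_set `<=` [set w | 0 <= w] ;
  weight_set_neq0 : weight_set !=set0 }.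

(* A weight set as a type, with the trace of the Borel sigma-algebra. *)
Definition weights (R : realType) (W : weightSet R) : Type := set_type W.

Definition wval (R : realType) (W : weightSet R) (w : weights W) : R := val w.

Section weights.
Context (R : realType) (W : weightSet R).

Let pt : weights W :=
  exist _ (sval (cid (weight_set_neq0 W)))
    (mem_set (svalP (cid (weight_set_neq0 W)))).

HB.instance Definition _ := Choice.on (weights W).
HB.instance Definition _ := isPointed.Build (weights W) pt.
HB.instance Definition _ :=
  Measurable.copy (weights W) (g_sigma_algebra_preimageType (@wval R W)).

Lemma wval_ge0 (w : weights W) : 0 <= wval w.
Proof. exact/weight_set_ge0/set_valP. Qed.

Lemma measurable_wval : measurable_fun setT (@wval R W).
Proof. by move=> _ B mB; exists B. Qed.

End weights.

Arguments wval {R W} w.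
Arguments measurable_wval {R W}.

Record weightKernel d (X : measurableType d) (R : realType) (W : weightSet R) :=
  WeightKernel {
  weight_kernel :> R.-pker X ~> weights W ;
  weight_kernel_mean1 : forall x,
    (\int[weight_kernel x]_w (wval w)%:E = 1)%E }.

(* pi_x(dw) = w Q_x(dw) *)
Section size_biased.
Local Open Scope ereal_scope.
Context d (X : measurableType d) (R : realType) (W : weightSet R).
Variable Q : weightKernel X W.

Definition sized (x : X) (A : set (weights W)) : \bar R :=
  \int[Q x]_(w in A) (wval w)%:E.

Let sized0 x : sized x set0 = 0.
Proof. exact: integral_set0. Qed.

Let sized_ge0 x A : 0 <= sized x A.
Proof. by apply: integral_ge0 => w _; rewrite lee_fin wval_ge0. Qed.

Let sized_sigma_additive x : semi_sigma_additive (sized x).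
Proof.
move=> F mF tF mUF; rewrite /sized ge0_integral_bigcup//.
- by apply: is_cvg_ereal_nneg_natsum_cond => n _ _; exact: sized_ge0.
- by apply/measurable_EFinP; apply: measurable_funTS; exact: measurable_wval.
- by move=> w _; rewrite lee_fin wval_ge0.
Qed.

HB.instance Definition _ x := isMeasure.Build _ _ _ (sized x)
  (sized0 x) (sized_ge0 x) (@sized_sigma_additive x).

Definition sized_kernel : X -> {measure set (weights W) -> \bar R} := sized.

Let measurable_sized A : measurable A ->
  measurable_fun [set: X] (sized_kernel ^~ A).
Proof.
move=> mA; rewrite (_ : sized_kernel ^~ A =
    (fun x => \int[Q x]_w (((fun w => (wval w)%:E) \_ A) w))); last first.
  by apply/funext => x; rewrite /sized_kernel/= /sized integral_mkcond.
apply: measurable_fun_integral_kernel.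
- by move=> U mU; exact: measurable_kernel.
- by move=> w; apply: erestrict_ge0 => ? _; rewrite lee_fin wval_ge0.
- apply/(measurable_restrictT _ _).1 => //.
  by apply/measurable_EFinP; apply: measurable_funTS; exact: measurable_wval.
Qed.

HB.instance Definition _ :=
  isKernel.Build _ _ _ _ _ sized_kernel measurable_sized.

Let sized_setT x : sized_kernel x setT = 1.
Proof. exact: weight_kernel_mean1. Qed.

HB.instance Definition _ :=
  Kernel_isProbability.Build _ _ _ _ _ sized_kernel sized_setT.

End size_biased.

(* The kernel (x, w) |-> q(x, dy) k_y(du). *)
Section proposal.
Local Open Scope ereal_scope.
Context d (X : measurableType d) (R : realType) (W : weightSet R).
Variables (q : R.-pker X ~> X) (k : R.-pker X ~> weights W).

Definition proposal (z : X * weights W) :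
  {measure set (X * weights W) -> \bar R} := semiprod (q z.1) k.

Let measurable_proposal A : measurable A ->
  measurable_fun [set: X * weights W] (proposal ^~ A).
Proof.
move=> mA; apply: (@measurable_fun_integral_kernel _ _ _ _ _ (q \o fst)
  _ (fun y => k y (xsection A y))) => //.
- move=> U mU.
  exact: (measurableT_comp (measurable_kernel q _ mU) measurable_fst).
- by apply: measurable_fun_xsection_finite_kernel; exact: mem_set.
Qed.

HB.instance Definition _ :=
  isKernel.Build _ _ _ _ _ proposal measurable_proposal.

Let proposal_setT z : proposal z setT = 1.
Proof.
rewrite /proposal/= /semiprod (eq_integral (cst 1)).
  by rewrite integral_cst// mul1e prob_kernel.
move=> x _; rewrite (_ : xsection _ _ = setT) ?prob_kernel//.
by apply/seteqP; split => // y _; rewrite /xsection/= inE.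
Qed.

HB.instance Definition _ :=
  Kernel_isProbability.Build _ _ _ _ _ proposal proposal_setT.

End proposal.

(* Accept the move drawn from k with probability a, otherwise stay put with
   mass rho, which is 1 - \int a(z, z') k(z, dz') in both uses below. *)
Section accept_reject.
Local Open Scope ereal_scope.
Context d (T : measurableType d) (R : realType).
Variables (k : R.-pker T ~> T) (a : T -> T -> R) (rho : T -> R).

Definition accept_reject (z : T) (A : set T) : \bar R :=
  \int[k z]_(z' in A) (a z z')%:E + (rho z)%:E * \d_z A.

Hypothesis ma : measurable_fun setT (fun zz : T * T => a zz.1 zz.2).
Hypothesis a_ge0 : forall z z', (0 <= a z z')%R.
Hypothesis a_le1 : forall z z', (a z z' <= 1)%R.
Hypothesis rhoE : forall z, rho z = (1 - \int[k z]_z' a z z')%R.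

Let ma1 z : measurable_fun setT (fun z' => (a z z')%:E).
Proof.
apply/measurable_EFinP.
exact: (measurableT_comp ma (measurable_pair1 z)).
Qed.

Let int_le1 z : \int[k z]_z' (a z z')%:E <= 1.
Proof.
apply: (@le_trans _ _ (\int[k z]_z' (cst 1 z'))); last first.
  by rewrite integral_cst// mul1e prob_kernel.
by apply: ge0_le_integral => // z' _; rewrite lee_fin.
Qed.

Let int_fin z : \int[k z]_z' (a z z')%:E \is a fin_num.
Proof.
rewrite ge0_fin_numE; last by apply: integral_ge0 => z' _; rewrite lee_fin.
by rewrite (le_lt_trans (int_le1 z))// ltry.
Qed.

Let rho_ge0 z : (0 <= rho z)%R.
Proof. by rewrite rhoE subr_ge0 -lee_fin /Rintegral fineK. Qed.

Lemma accept_reject0 z : accept_reject z set0 = 0.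
Proof. by rewrite /accept_reject integral_set0 measure0 mule0 adde0. Qed.

Lemma accept_reject_ge0 z A : 0 <= accept_reject z A.
Proof.
apply: adde_ge0; first by apply: integral_ge0 => z' _; rewrite lee_fin.
by apply: mule_ge0; rewrite ?lee_fin.
Qed.

Lemma accept_reject_sigma_additive z : semi_sigma_additive (accept_reject z).
Proof.
move=> F mF tF mUF.
rewrite (_ : accept_reject z (\bigcup_n F n) =
    \sum_(n <oo) accept_reject z (F n)).
  by apply: is_cvg_ereal_nneg_natsum_cond => n _ _; exact: accept_reject_ge0.
rewrite /accept_reject nneseriesD//; last 2 first.
- by move=> n _ _; apply: integral_ge0 => z' _; rewrite lee_fin.
- by move=> n _ _; apply: mule_ge0; rewrite ?lee_fin.
rewrite ge0_integral_bigcup//; last 2 first.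
- exact: measurable_funTS.
- by move=> z' _; rewrite lee_fin.
congr (_ + _).
rewrite nneseriesZl//; congr (_ * _).
by apply/esym/cvg_lim => //; exact: measure_semi_sigma_additive.
Qed.

Lemma measurable_accept_reject A : measurable A ->
  measurable_fun [set: T] (accept_reject ^~ A).
Proof.
move=> mA; apply: emeasurable_funD.
  under eq_fun do rewrite integral_mkcond.
  have mres : measurable_fun setT
      (fun zz : T * T => ((fun z' => (a zz.1 z')%:E) \_ A) zz.2).
    rewrite (_ : (fun _ => _) =
        (fun zz : T * T => (a zz.1 zz.2 * \1_A zz.2)%:E)); last first.
      apply/funext => -[z z'] /=; rewrite patchE indicE.
      by case: ifPn; rewrite ?mulr1 ?mulr0.
    apply/measurable_EFinP; apply: measurable_funM => //.
    by apply: measurableT_comp => //; exact: measurable_indic.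
  apply: (@measurable_fun_integral_finite_kernel _ _ _ _ _
    (fun zz : T * T => ((fun z' => (a zz.1 z')%:E) \_ A) zz.2) k) => //.
  by move=> [z z']; apply: erestrict_ge0 => ? _; rewrite lee_fin.
apply: emeasurable_funM; last exact: (measurable_fun_dirac mA).
apply/measurable_EFinP; rewrite (_ : rho = fun z => 1 - \int[k z]_z' a z z')%R.
  apply: measurable_funB => //.
  apply: (measurableT_comp (fine_measurable measurableT)) => //.
  apply: (@measurable_fun_integral_finite_kernel _ _ _ _ _
    (fun zz : T * T => (a zz.1 zz.2)%:E) k) => //.
  - by move=> zz; rewrite lee_fin.
  - exact/measurable_EFinP.
by apply/funext => z.
Qed.

Lemma accept_reject_setT z : accept_reject z setT = 1.
Proof.
rewrite /accept_reject diracT mule1 rhoE EFinB /Rintegral fineK//.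
by rewrite addeC subeK.
Qed.

End accept_reject.

Section kernels.
Context d (X : measurableType d) (R : realType) (pi : probability X R).
Variables (q : R.-pker X ~> X) (r : tierneyRatio pi q).
Variables (W : weightSet R) (Q : weightKernel X W).
Local Notation Z := (X * weights W)%type.

(* pi(dx) pi_x(dw) *)
Definition pm_target : set Z -> \bar R := semiprod pi (sized_kernel Q).

HB.instance Definition _ := Probability.on pm_target.

(* min{1, r(x, y) u / w}, read as 1 when w = 0 *)
Definition pm_accept (z z' : Z) : R :=
  if wval z.2 == 0 then 1
  else Num.min 1 (r (z.1, z'.1) * (wval z'.2 / wval z.2)).

Definition pm_reject (z : Z) : R :=
  1 - \int[proposal q Q z]_z' pm_accept z z'.

Definition pm_kernel (z : Z) : set Z -> \bar R :=
  accept_reject (proposal q Q) pm_accept pm_reject z.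

Definition mh_accept (x y : X) : R := Num.min 1 (r (x, y)).

Definition mh_reject (x : X) : R := 1 - \int[q x]_y mh_accept x y.

Definition aux_kernel (z : Z) : set Z -> \bar R :=
  accept_reject (proposal q (sized_kernel Q))
    (fun z z' : Z => mh_accept z.1 z'.1) (fun z : Z => mh_reject z.1) z.

Section pm_kernel.

Let mr1 : measurable_fun setT (fun zz : Z * Z => r (zz.1.1, zz.2.1)).
Proof.
apply: measurableT_comp; first exact: measurable_tierney_ratio.
by apply: measurable_fun_pair; exact: measurableT_comp.
Qed.

Let mpm_accept : measurable_fun setT (fun zz : Z * Z => pm_accept zz.1 zz.2).
Proof.
have mw1 : measurable_fun setT (fun zz : Z * Z => wval zz.1.2).
  apply: measurableT_comp; first exact: measurable_wval.
  exact: measurableT_comp.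
have mw2 : measurable_fun setT (fun zz : Z * Z => wval zz.2.2).
  apply: measurableT_comp; first exact: measurable_wval.
  exact: measurableT_comp.
apply: measurable_fun_ifT => //.
  exact: measurable_fun_eqr.
apply: measurable_minr => //; apply: measurable_funM => //.
apply: measurable_funM => //.
under eq_fun do rewrite -(powR_inv1 (wval_ge0 _)).
exact: (measurableT_comp (measurable_powR _)).
Qed.

Let pm_accept_ge0 z z' : 0 <= pm_accept z z'.
Proof.
rewrite /pm_accept; case: ifPn => // _.
by rewrite le_min ler01/= mulr_ge0 ?tierney_ge0// divr_ge0 ?wval_ge0.
Qed.

Let pm_accept_le1 z z' : pm_accept z z' <= 1.
Proof. by rewrite /pm_accept; case: ifPn => // _; rewrite ge_min lexx. Qed.

Let pm_kernel0 z : pm_kernel z set0 = 0%E.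
Proof. exact: accept_reject0. Qed.

Let pm_kernel_ge0 z A : (0 <= pm_kernel z A)%E.
Proof. exact: accept_reject_ge0. Qed.

Let pm_kernel_sigma_additive z : semi_sigma_additive (pm_kernel z).
Proof. exact: accept_reject_sigma_additive. Qed.

HB.instance Definition _ z := isMeasure.Build _ _ _ (pm_kernel z)
  (pm_kernel0 z) (pm_kernel_ge0 z) (@pm_kernel_sigma_additive z).

Definition pseudo_marginal : Z -> {measure set Z -> \bar R} := pm_kernel.

Let measurable_pm_kernel A : measurable A ->
  measurable_fun [set: Z] (pseudo_marginal ^~ A).
Proof. by move=> mA; exact: measurable_accept_reject. Qed.

HB.instance Definition _ :=
  isKernel.Build _ _ _ _ _ pseudo_marginal measurable_pm_kernel.

Let pm_kernel_setT z : pseudo_marginal z setT = 1%E.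
Proof. exact: accept_reject_setT. Qed.

HB.instance Definition _ :=
  Kernel_isProbability.Build _ _ _ _ _ pseudo_marginal pm_kernel_setT.

End pm_kernel.

Section aux_kernel.

Let a (z z' : Z) : R := mh_accept z.1 z'.1.

Let ma : measurable_fun setT (fun zz : Z * Z => a zz.1 zz.2).
Proof.
apply: measurable_minr => //.
apply: measurableT_comp; first exact: measurable_tierney_ratio.
by apply: measurable_fun_pair; exact: measurableT_comp.
Qed.

Let a_ge0 z z' : 0 <= a z z'.
Proof. by rewrite /a /mh_accept le_min ler01/= tierney_ge0. Qed.

Let a_le1 z z' : a z z' <= 1.
Proof. by rewrite /a /mh_accept ge_min lexx. Qed.

Let rhoE (z : Z) :
  mh_reject z.1 = 1 - \int[proposal q (sized_kernel Q) z]_z' a z z'.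
Proof.
congr (1 - fine _).
transitivity (\int[pushforward (proposal q (sized_kernel Q) z) fst]_y
    (mh_accept z.1 y)%:E)%E.
  apply: eq_measure_integral => A mA _; rewrite /= /pushforward /semiprod.
  rewrite [RHS](eq_integral (fun x => (\1_A x)%:E)); last first.
    move=> x _; rewrite indicE.
    have -> : xsection (fst @^-1` A) x =
        if x \in A then setT else set0 :> set (weights W).
      apply/seteqP; split=> w /=; rewrite /xsection/= !inE/=.
        by move=> Ax; rewrite mem_set.
      by case: ifPn => // /set_mem.
    by case: ifPn => _; [exact: prob_kernel|exact: measure0].
  by rewrite integral_indic// setIT.
rewrite ge0_integral_pushforward//.
- apply/measurable_EFinP; apply: measurable_minr => //.
  apply: measurableT_comp; first exact: measurable_tierney_ratio.
  exact: measurable_fun_pair.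
- by move=> y _; rewrite lee_fin le_min ler01/= tierney_ge0.
Qed.

Let aux_kernel0 z : aux_kernel z set0 = 0%E.
Proof. exact: accept_reject0. Qed.

Let aux_kernel_ge0 z A : (0 <= aux_kernel z A)%E.
Proof. exact: accept_reject_ge0. Qed.

Let aux_kernel_sigma_additive z : semi_sigma_additive (aux_kernel z).
Proof. exact: accept_reject_sigma_additive. Qed.

HB.instance Definition _ z := isMeasure.Build _ _ _ (aux_kernel z)
  (aux_kernel0 z) (aux_kernel_ge0 z) (@aux_kernel_sigma_additive z).

Definition auxiliary : Z -> {measure set Z -> \bar R} := aux_kernel.

Let measurable_aux_kernel A : measurable A ->
  measurable_fun [set: Z] (auxiliary ^~ A).
Proof. by move=> mA; exact: measurable_accept_reject. Qed.

HB.instance Definition _ :=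
  isKernel.Build _ _ _ _ _ auxiliary measurable_aux_kernel.

Let aux_kernel_setT z : auxiliary z setT = 1%E.
Proof. exact: accept_reject_setT. Qed.

HB.instance Definition _ :=
  Kernel_isProbability.Build _ _ _ _ _ auxiliary aux_kernel_setT.

End aux_kernel.

End kernels.

(* Dirichlet form and right spectral gap of a Markov kernel P with respect to
   mu.  The gap is an infimum in the extended reals, hence +oo when every
   square-integrable function has zero variance. *)
Section spectral_gap.
Context d (T : measurableType d) (R : realType).
Variables (mu : probability T R) (P : R.-pker T ~> T).

Definition square_integrable (g : T -> R) : Prop :=
  measurable_fun setT g /\ (\int[mu]_x (g x ^+ 2)%:E < +oo)%E.

Definition dirichlet (g : T -> R) : R :=
  \int[mu]_x (g x * (g x - \int[P x]_y g y)).

Definition gap : \bar R := ereal_inf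
  [set (dirichlet g / fine 'V_mu[g])%:E | g in
    [set g : T -> R | square_integrable g /\ (0 < 'V_mu[g])%E]].

End spectral_gap.

(* Main.v *)
Require Import Defs.
From HB Require Import structures.
From mathcomp Require Import all_boot all_order all_algebra.
From mathcomp Require Import all_classical all_reals all_analysis.
From mathcomp Require Import measurable_realfun ring lra.

Set Implicit Arguments.
Unset Strict Implicit.
Unset Printing Implicit Defensive.
Import Order.TTheory GRing.Theory Num.Theory.
Import numFieldNormedType.Exports.

Local Open Scope classical_set_scope.
Local Open Scope ring_scope.

(** Write [t] for [r (x, y)].  Both kernels accept or reject a proposal, so each
    Dirichlet form only sees the accepted moves.  Relative to the common measure
    [pi(dx) q(x, dy) Q_x(dw) Q_y(du)], the stationary rate of accepted moves from
    [(x, w)] to [(y, u)] has density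

      [w * min 1 (t * u / w) = min w (t * u)]   for the pseudo-marginal kernel,
      [w * u * min 1 t]                         for the auxiliary kernel.

    Since [w * u * min 1 t = min (w * u) (t * w * u)], the second density is at
    most [wbar] times the first as soon as [w] and [u] lie in [[0, wbar]]: bound
    [u] by [wbar] in the first argument of the minimum and [w] by [wbar] in the
    second one.  Integrating half the squared increment of [f] against the two
    densities compares the Dirichlet forms, and the comparison of the gaps
    follows by taking infima of the Rayleigh quotients.

    Three points need work.

    The Dirichlet form is [<f, (I - P) f>], and it equals half the integral of
    [(f z - f z')^2] against the flow of accepted moves only if both marginals of
    that flow agree ([dirichlet_accept_rejectE]).  They do because both densities
    satisfy [b t w u = t * b (1 / t) u w]: the factor [t] is the density of the
    reversed proposal measure on the set where it is equivalent to the forward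
    one, so exchanging the end points of a move preserves the flow ([flow_sym]).

    The iterated integrals defining the two kernels have to be rewritten over the
    common measure, which takes an integration formula for semidirect products
    and densities, and an exchange of the order of integration
    ([integral_target_proposal]).

    The bound on the weights holds for [pi]-almost every point.  It transfers at
    once to the starting point [x] of a move, whose law is [pi].  The law of the
    proposed point [y] need not be absolutely continuous with respect to [pi],
    but off the Tierney set [t = 0] and both densities vanish, while on it the
    proposal measure is dominated by its reversal, under which [y] has law [pi]
    ([ae_flow_weight_le]). *)

(** * Integration against mixtures, densities and semidirect products *)

Section mixture.
Local Open Scope ereal_scope.
Import HBNNSimple.
Context d d' (X : measurableType d) (Y : measurableType d') (R : realType).
Variables (m : {measure set X -> \bar R}) (k : R.-ker X ~> Y).
Variable nu : {measure set Y -> \bar R}.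
Hypothesis nuE : forall A, measurable A -> nu A = \int[m]_x k x A.

Let integral_mixture_nnsfun (f : {nnsfun Y >-> R}) :
  \int[nu]_y (f y)%:E = \int[m]_x \int[k x]_y (f y)%:E.
Proof.
under [RHS]eq_integral do rewrite integralT_nnsfun sintegralE.
rewrite integralT_nnsfun sintegralE ge0_integral_fsum//; last 2 first.
- by move=> r; apply: measurable_funeM; exact: measurable_kernel.
- by move=> r x _; exact: nnsfun_mulemu_ge0.
apply: eq_fsbigr => r _; rewrite nuE//.
have [r0|r0] := leP 0%R r.
  by rewrite ge0_integralZl//; exact: measurable_kernel.
rewrite preimage_nnfun0// !integral0_eq ?mule0//= => x _.
all: by rewrite measure0 ?mule0.
Qed.

(** Densities, semidirect products and accept-reject kernels are all mixtures of
    simple kernels, so that their integration formulas are instances of this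
    one. *)
Lemma ge0_integral_mixture (f : Y -> \bar R) :
  (forall y, 0 <= f y) -> measurable_fun setT f ->
  \int[nu]_y f y = \int[m]_x \int[k x]_y f y.
Proof.
move=> f0 mf; pose f_ := nnsfun_approx measurableT mf.
have limf (mu : {measure set Y -> \bar R}) :
    \int[mu]_y f y = limn (fun n => \int[mu]_y (f_ n y)%:E).
  rewrite -monotone_convergence//.
  - by apply: eq_integral => y _; apply/esym/cvg_lim => //;
      exact: cvg_nnsfun_approx.
  - by move=> n; exact/measurable_EFinP.
  - by move=> n y _; rewrite lee_fin.
  - by move=> y _ a b ab; rewrite lee_fin; exact/lefP/nd_nnsfun_approx.
rewrite limf; under [in RHS]eq_integral do rewrite limf.
rewrite monotone_convergence//.
- by congr (limn _); apply/funext => n; exact: integral_mixture_nnsfun.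
- move=> n; apply: measurable_fun_integral_kernel.
  + by move=> U mU; exact: measurable_kernel.
  + by move=> z; rewrite lee_fin.
  + exact/measurable_EFinP.
- by move=> n x _; apply: integral_ge0 => y _; rewrite lee_fin.
- move=> x _ a b ab; apply: ge0_le_integral => //.
  + by move=> y _; rewrite lee_fin.
  + exact/measurable_EFinP.
  + exact/measurable_EFinP.
  + by move=> y _; rewrite lee_fin; exact/lefP/nd_nnsfun_approx.
Qed.

End mixture.

Section density.
Local Open Scope ereal_scope.
Context d (X : measurableType d) (R : realType) (h : X -> R).
Hypothesis mh : measurable_fun setT h.
Hypothesis h0 : forall x, (0 <= h x)%R.

(** The kernel whose mixture under [m] is the measure of density [h]. *)
Definition point_mass (x : X) : {measure set X -> \bar R} :=
  mscale (NngNum (h0 x)) (@dirac _ X x R).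

Let measurable_point_mass U : measurable U ->
  measurable_fun [set: X] (point_mass ^~ U).
Proof.
move=> mU; apply: emeasurable_funM; first exact/measurable_EFinP.
exact: measurable_fun_dirac.
Qed.

HB.instance Definition _ :=
  isKernel.Build _ _ _ _ _ point_mass measurable_point_mass.

Lemma ge0_integral_density (m nu : {measure set X -> \bar R})
    (f : X -> \bar R) :
  (forall A, measurable A -> nu A = \int[m]_(x in A) (h x)%:E) ->
  (forall x, 0 <= f x) -> measurable_fun setT f ->
  \int[nu]_x f x = \int[m]_x ((h x)%:E * f x).
Proof.
move=> nuE f0 mf.
rewrite (ge0_integral_mixture (m := m) (k := point_mass))//.
  apply: eq_integral => x _; rewrite ge0_integral_mscale// integral_dirac//.
  by rewrite diracT mul1e.
move=> A mA; rewrite nuE// integral_mkcond; apply: eq_integral => x _.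
rewrite patchE /= /mscale/= diracE.
by case: ifPn => _; rewrite ?mule1 ?mule0.
Qed.

End density.

Section semiprod_integral.
Local Open Scope ereal_scope.
Context d d' (X : measurableType d) (Y : measurableType d') (R : realType).
Variable (k : R.-fker X ~> Y).

(** The image of [k x] under [y |-> (x, y)], whose mixture under [m] is
    [semiprod m k]. *)
Definition graph_kernel (x : X) : {measure set (X * Y) -> \bar R} :=
  semiprod (@dirac _ X x R) k.

Let graph_kernelE x A : measurable A -> graph_kernel x A = k x (xsection A x).
Proof.
move=> mA; rewrite /graph_kernel/= /semiprod integral_dirac ?diracT ?mul1e//.
by apply: measurable_fun_xsection_finite_kernel; exact: mem_set.
Qed.

Let measurable_graph_kernel A : measurable A ->
  measurable_fun [set: X] (graph_kernel ^~ A).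
Proof.
move=> mA; rewrite (_ : (graph_kernel ^~ A) = fun x => k x (xsection A x)).
  by apply: measurable_fun_xsection_finite_kernel; exact: mem_set.
by apply/funext => x; exact: graph_kernelE.
Qed.

HB.instance Definition _ :=
  isKernel.Build _ _ _ _ _ graph_kernel measurable_graph_kernel.

Lemma ge0_integral_semiprod (m : {measure set X -> \bar R})
    (f : X * Y -> \bar R) :
  (forall z, 0 <= f z) -> measurable_fun setT f ->
  \int[semiprod m k]_z f z = \int[m]_x \int[k x]_y f (x, y).
Proof.
move=> f0 mf; rewrite (ge0_integral_mixture (m := m) (k := graph_kernel))//.
  apply: eq_integral => x _.
  rewrite (eq_measure_integral (pushforward (k x) (pair x))); last first.
    by move=> A mA _; rewrite graph_kernelE// /pushforward xsectionE.
  by rewrite ge0_integral_pushforward//; exact: measurable_pair1.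
move=> A mA; apply: eq_integral => x _.
by rewrite graph_kernelE.
Qed.

End semiprod_integral.

Section semiprod_integrable.
Local Open Scope ereal_scope.
Context d d' (X : measurableType d) (Y : measurableType d') (R : realType).

Let integral_sectionE (k : R.-fker X ~> Y) (f : X * Y -> \bar R) x :
  \int[k x]_y f (x, y) = \int[k x]_y f^\+ (x, y) - \int[k x]_y f^\- (x, y).
Proof.
by rewrite integralE; congr (_ - _); apply: eq_integral => y _;
  rewrite ?funeposE ?funenegE.
Qed.

Lemma measurable_fun_integral_section (k : R.-fker X ~> Y)
    (f : X * Y -> \bar R) :
  measurable_fun setT f -> measurable_fun setT (fun x => \int[k x]_y f (x, y)).
Proof.
move=> mf; under eq_fun do rewrite integral_sectionE.
have mfp := measurable_funepos mf; have mfn := measurable_funeneg mf.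
have hp := @measurable_fun_integral_finite_kernel _ _ _ _ _ f^\+ k
  (funepos_ge0 f) mfp.
have hn := @measurable_fun_integral_finite_kernel _ _ _ _ _ f^\- k
  (funeneg_ge0 f) mfn.
exact: emeasurable_funB.
Qed.

Variables (m : {measure set X -> \bar R}) (k : R.-fker X ~> Y).
Variable f : X * Y -> \bar R.
Hypothesis intf : (semiprod m k).-integrable setT f.

Let mf : measurable_fun setT f. Proof. exact: measurable_int intf. Qed.

Let integrable_section_integral (g : X * Y -> \bar R) :
  measurable_fun setT g -> (forall z, 0 <= g z) -> (forall z, g z <= `|f z|) ->
  m.-integrable setT (fun x => \int[k x]_y g (x, y)).
Proof.
move=> mg g0 gf; apply/integrableP; split.
  exact: measurable_fun_integral_section.
under eq_integral do rewrite gee0_abs ?integral_ge0//.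
rewrite -ge0_integral_semiprod//.
move/integrableP : intf => [_]; apply: le_lt_trans.
by apply: ge0_le_integral => //; exact: measurableT_comp.
Qed.

Lemma integrable_semiprod_section :
  {ae m, forall x, (k x).-integrable setT (fun y => f (x, y))}.
Proof.
have /integrable_ae : m.-integrable setT (fun x => \int[k x]_y `|f (x, y)|).
  by apply: (integrable_section_integral (g := fun z => `|f z|)) => //=;
    exact: measurableT_comp.
move=> /(_ measurableT); apply: filterS => x /(_ Logic.I) fx.
apply/integrableP; split; first exact: (measurableT_comp mf).
by rewrite -ge0_fin_numE// integral_ge0.
Qed.

Lemma integral_semiprod :
  \int[semiprod m k]_z f z = \int[m]_x \int[k x]_y f (x, y).
Proof.
have mfp := measurable_funepos mf; have mfn := measurable_funeneg mf.
rewrite [LHS]integralE !ge0_integral_semiprod// -integralB//.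
- by apply: eq_integral => x _; exact/esym/integral_sectionE.
- apply: (integrable_section_integral (g := f^\+)) => // z.
  by rewrite funeposE maxEge; case: ifPn => // _; exact: lee_abs.
- apply: (integrable_section_integral (g := f^\-)) => // z.
  by rewrite funenegE maxEge -abseN; case: ifPn => // _; exact: lee_abs.
Qed.

End semiprod_integrable.

(** * The Dirichlet form of an accept-reject kernel *)

Section accept_reject_dirichlet.
Context d (T : measurableType d) (R : realType).
Variables (mu : probability T R) (k P : R.-pker T ~> T).
Variables (a : T -> T -> R) (rho : T -> R).
Hypothesis ma : measurable_fun setT (fun zz : T * T => a zz.1 zz.2).
Hypothesis a_ge0 : forall z z', 0 <= a z z'.
Hypothesis a_le1 : forall z z', a z z' <= 1.
Hypothesis PE : forall z A, P z A = accept_reject k a rho z A.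

Let ma1 z : measurable_fun setT (a z).
Proof. exact: (measurableT_comp ma (measurable_pair1 z)). Qed.

Let integrable_le1 z (g : T -> R) : measurable_fun setT g ->
  (forall z', `|g z'| <= 1) -> (k z).-integrable setT (EFin \o g).
Proof.
move=> mg g1; apply: measurable_bounded_integrable => //.
  by rewrite prob_kernel ltry.
by exists 1; split => // e e1 z' _; apply: le_trans (g1 z') (ltW e1).
Qed.

Let integrable_a z : (k z).-integrable setT (EFin \o a z).
Proof. by apply: integrable_le1 => // z'; rewrite ger0_norm. Qed.

(* the total mass of P z is 1 *)
Let rhoE z : rho z = 1 - \int[k z]_z' a z z'.
Proof.
have := @prob_kernel _ _ _ _ _ P z; rewrite PE /accept_reject diracT mule1.
have := integrable_fin_num measurableT (integrable_a z).
rewrite /Rintegral /comp; case: (integral _ _ _) => // p _ [] <-.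
by rewrite addrAC subrr add0r.
Qed.

Let rho_ge0 z : 0 <= rho z.
Proof.
rewrite rhoE subr_ge0 -lee_fin /Rintegral fineK; last first.
  exact: integrable_fin_num (integrable_a z).
apply: (@le_trans _ _ (\int[k z]_z' (cst 1 z')))%E; last first.
  by rewrite integral_cst// mul1e prob_kernel.
apply: ge0_le_integral => //.
- by move=> z' _; rewrite lee_fin.
- exact/measurable_EFinP.
- by move=> z' _; rewrite lee_fin.
Qed.

Let a_le1' z z' : 0 <= 1 - a z z'. Proof. by rewrite subr_ge0. Qed.

(** One step from [z] once [z'] has been proposed.  The mixture of these measures
    over the proposal is the accept-reject kernel, because the rejection mass
    [rho z] is the mean of [1 - a z z']. *)
Definition accept_or_stay (z z' : T) : {measure set T -> \bar R} :=
  measure_add (mscale (NngNum (a_ge0 z z')) (@dirac _ T z' R))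
    (mscale (NngNum (a_le1' z z')) (@dirac _ T z R)).

Let accept_or_stayE z z' A :
  (accept_or_stay z z' A = (a z z')%:E * \d_z' A + (1 - a z z')%:E * \d_z A)%E.
Proof. exact: measure_addE. Qed.

Let measurable_accept_or_stay z A : measurable A ->
  measurable_fun [set: T] (fun z' => accept_or_stay z z' A).
Proof.
move=> mA; under eq_fun do rewrite accept_or_stayE.
apply: emeasurable_funD; apply: emeasurable_funM => //.
- exact/measurable_EFinP.
- exact: measurable_fun_dirac.
- by apply/measurable_EFinP; exact: measurable_funB.
Qed.

HB.instance Definition _ z :=
  isKernel.Build _ _ _ _ _ (accept_or_stay z)
    (@measurable_accept_or_stay z).

Lemma ge0_integral_accept_reject z (f : T -> \bar R) :
  (forall z', 0 <= f z')%E -> measurable_fun setT f ->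
  (\int[P z]_z' f z' =
   \int[k z]_z' ((a z z')%:E * f z') + (rho z)%:E * f z)%E.
Proof.
move=> f0 mf.
have ma' : measurable_fun setT (fun z' => (1 - a z z')%:E).
  by apply/measurable_EFinP; exact: measurable_funB.
have rE : ((rho z)%:E = \int[k z]_z' (1 - a z z')%:E)%E.
  under eq_integral do rewrite EFinB.
  rewrite integralB_EFin//; last first.
    by apply: (@integrable_le1 z (cst 1)) => //= z'; rewrite normr1.
  rewrite integral_cst// mul1e prob_kernel rhoE EFinB /Rintegral fineK//.
  exact: integrable_fin_num (integrable_a z).
have mixE (g : T -> \bar R) : (forall z', 0 <= g z')%E ->
    measurable_fun setT g ->
    (\int[k z]_z' ((a z z')%:E * g z' + (1 - a z z')%:E * g z) =
     \int[k z]_z' ((a z z')%:E * g z') + (rho z)%:E * g z)%E.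
  move=> g0 mg; rewrite ge0_integralD//.
  - by rewrite ge0_integralZr// ?rE// => z' _; rewrite lee_fin.
  - by move=> z' _; rewrite mule_ge0// lee_fin.
  - by apply: emeasurable_funM => //; exact/measurable_EFinP.
  - by move=> z' _; rewrite mule_ge0// lee_fin.
  - exact: emeasurable_funM.
rewrite -mixE// (ge0_integral_mixture (m := k z) 
  (k := accept_or_stay z))//.
  apply: eq_integral => z' _.
  by rewrite ge0_integral_measure_add// !ge0_integral_mscale// !integral_dirac//
    !diracT !mul1e.
move=> A mA; rewrite PE /accept_reject integral_mkcond.
under [RHS]eq_integral do rewrite accept_or_stayE.
have mdA : measurable_fun setT (fun z' => \d_z' A : \bar R).
  exact: measurable_fun_dirac.
rewrite mixE//; congr (_ + _); apply: eq_integral => z' _.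
by rewrite patchE diracE; case: ifPn => _; rewrite ?mule1 ?mule0.
Qed.

Lemma integral_accept_reject z (f : T -> R) : measurable_fun setT f ->
  (k z).-integrable setT (fun z' => (a z z' * f z')%:E) ->
  (\int[P z]_z' (f z')%:E =
   \int[k z]_z' (a z z' * f z')%:E + (rho z * f z)%:E)%E.
Proof.
move=> mf intf.
have mF : measurable_fun setT (EFin \o f) by exact/measurable_EFinP.
rewrite integralE [in RHS]integralE.
rewrite !ge0_integral_accept_reject//; last 2 first.
- exact: measurable_funeneg.
- exact: measurable_funepos.
have pE z' : ((a z z')%:E * (EFin \o f)^\+ z' =
    (fun z' => (a z z' * f z')%:E)^\+ z')%E.
  rewrite !funeposE/=; have [f0|/ltW f0] := leP 0 (f z').
    by rewrite !max_l ?lee_fin ?mulr_ge0.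
  by rewrite !max_r ?lee_fin ?mulr_ge0_le0// mule0.
have nE z' : ((a z z')%:E * (EFin \o f)^\- z' =
    (fun z' => (a z z' * f z')%:E)^\- z')%E.
  rewrite !funenegE/=; have [f0|/ltW f0] := leP 0 (f z').
    by rewrite !max_r ?mule0// lee_fin oppr_le0// mulr_ge0.
  by rewrite !max_l ?lee_fin ?oppr_ge0 ?mulr_ge0_le0// -EFinM mulrN.
under eq_integral do rewrite pE.
under [X in (_ - (X + _))%E = _]eq_integral do rewrite nE.
have := integrable_pos_fin_num measurableT intf.
have := integrable_neg_fin_num measurableT intf.
rewrite funeposE funenegE/= -!EFin_max.
move: (integral _ _ _) (integral _ _ _) => [p| |] [n| |]//= _ _.
rewrite -?EFinM -?EFinB -?EFinD -?EFinB; congr EFin.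
have [f0|/ltW f0] := leP 0 (f z).
  by rewrite max_r ?oppr_le0//; ring.
by rewrite max_l ?oppr_ge0//; ring.
Qed.

(** Invariance of [mu] under [P], with the rejection terms cancelled. *)
Hypothesis balanced : forall phi : T -> \bar R,
  (forall z, 0 <= phi z)%E -> measurable_fun setT phi ->
  (\int[mu]_z \int[k z]_z' ((a z z')%:E * phi z') =
   \int[mu]_z \int[k z]_z' ((a z z')%:E * phi z))%E.

Section form.
Variable f : T -> R.
Hypothesis f2 : square_integrable mu f.

Let mf : measurable_fun setT f. Proof. by case: f2. Qed.

Let N := semiprod mu k.

(* the terms of the expansion of a(z, z') (f z - f z')^2 *)
Let g1 (zz : T * T) := a zz.1 zz.2 * f zz.1 ^+ 2.
Let g2 (zz : T * T) := a zz.1 zz.2 * f zz.2 ^+ 2.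
Let g12 (zz : T * T) := a zz.1 zz.2 * (f zz.1 * f zz.2).

Let mf1 : measurable_fun setT (fun zz : T * T => f zz.1).
Proof. exact: (measurableT_comp mf measurable_fst). Qed.

Let mf2 : measurable_fun setT (fun zz : T * T => f zz.2).
Proof. exact: (measurableT_comp mf measurable_snd). Qed.

Let mg1 : measurable_fun setT g1.
Proof. by apply: measurable_funM => //; exact: measurable_funX. Qed.

Let mg2 : measurable_fun setT g2.
Proof. by apply: measurable_funM => //; exact: measurable_funX. Qed.

Let mg12 : measurable_fun setT g12.
Proof. by apply: measurable_funM => //; exact: measurable_funM. Qed.

Let g1_ge0 zz : 0 <= g1 zz. Proof. by rewrite mulr_ge0 ?sqr_ge0. Qed.
Let g2_ge0 zz : 0 <= g2 zz. Proof. by rewrite mulr_ge0 ?sqr_ge0. Qed.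

Let g1_lty : (\int[N]_zz (g1 zz)%:E < +oo)%E.
Proof.
rewrite ge0_integral_semiprod//; last exact/measurable_EFinP.
case: f2 => _; apply: le_lt_trans; apply: ge0_le_integral => //.
- by move=> z _; apply: integral_ge0 => z' _; rewrite lee_fin.
- apply: (@measurable_fun_integral_section _ _ _ _ _ _ (EFin \o g1)).
  exact/measurable_EFinP.
- by apply/measurable_EFinP; exact: measurable_funX.
move=> z _; rewrite -[leRHS]mule1 -(@prob_kernel _ _ _ _ _ k z).
rewrite -integral_cst//; apply: ge0_le_integral => //.
- by move=> z' _; rewrite lee_fin.
- by apply/measurable_EFinP; exact: (measurableT_comp mg1 (measurable_pair1 z)).
- by move=> z' _; rewrite lee_fin ler_piMl// sqr_ge0.
Qed.

Let g2E : (\int[N]_zz (g2 zz)%:E = \int[N]_zz (g1 zz)%:E)%E.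
Proof.
rewrite !ge0_integral_semiprod//;
  [|exact/measurable_EFinP|exact/measurable_EFinP].
apply: (balanced (phi := fun z => (f z ^+ 2)%:E)).
  by move=> z; rewrite lee_fin sqr_ge0.
by apply/measurable_EFinP; exact: measurable_funX.
Qed.

Let int1 : N.-integrable setT (EFin \o g1).
Proof.
apply/integrableP; split; first exact/measurable_EFinP.
by under eq_integral do rewrite /= ger0_norm//.
Qed.

Let int2 : N.-integrable setT (EFin \o g2).
Proof.
apply/integrableP; split; first exact/measurable_EFinP.
by under eq_integral do rewrite /= ger0_norm//; rewrite g2E.
Qed.

Let int12 : N.-integrable setT (EFin \o g12).
Proof.
apply: (le_integrable _ _ _ (integrableD _ int1 int2)) => //.
  exact/measurable_EFinP.
move=> zz _; rewrite /= lee_fin [leRHS]ger0_norm ?addr_ge0//.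
rewrite /g12 /g1 /g2 -mulrDr normrM ger0_norm// ler_wpM2l//.
rewrite ler_norml; have := sqr_ge0 (f zz.1 + f zz.2).
have := sqr_ge0 (f zz.1 - f zz.2); have := sqr_ge0 (f zz.1).
have := sqr_ge0 (f zz.2); rewrite !expr2 => *; apply/andP; split; nra.
Qed.

(* the accepted part of P f is a convergent integral at almost every point *)
Let intaf : N.-integrable setT (fun zz => (a zz.1 zz.2 * f zz.2)%:E).
Proof.
have int_cst : N.-integrable setT (EFin \o cst 1).
  exact: finite_measure_integrable_cst.
apply: (le_integrable _ _ _ (integrableD _ int_cst int2)) => //.
  by apply/measurable_EFinP; exact: measurable_funM.
move=> zz _; rewrite /= lee_fin [leRHS]ger0_norm ?addr_ge0//.
rewrite /g2 normrM ger0_norm//.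
apply: (@le_trans _ _ (a zz.1 zz.2 * (1 + f zz.2 ^+ 2))).
  rewrite ler_wpM2l// ler_norml; have := sqr_ge0 (f zz.2 + 1).
  have := sqr_ge0 (f zz.2 - 1).
  by rewrite !expr2 => *; apply/andP; split; nra.
by rewrite mulrDr mulr1 lerD2r.
Qed.

(** Rejected moves contribute nothing, since
    [f z - P f z] is the integral of [a z z' * (f z - f z')].  Thus the Dirichlet
    form integrates [a z z' * (f z ^ 2 - f z * f z')], and by balance
    [f z ^ 2] may be replaced by the average of [f z ^ 2] and [f z' ^ 2]. *)
Lemma dirichlet_accept_rejectE :
  ((dirichlet mu P f)%:E = 2^-1%:E *
   \int[mu]_z \int[k z]_z' (a z z' * (f z - f z') ^+ 2)%:E)%E.
Proof.
pose h (zz : T * T) := g1 zz - g12 zz.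
have inth : N.-integrable setT (EFin \o h).
  exact: (integrableB measurableT int1 int12).
have -> : dirichlet mu P f = fine (\int[N]_zz (h zz)%:E)%E.
  rewrite integral_semiprod//; congr fine; apply: ae_eq_integral => //.
  - apply/measurable_EFinP; apply: measurable_funM => //.
    apply: measurable_funB => //.
    apply: (measurableT_comp (fine_measurable measurableT)) => //.
    apply: (@measurable_fun_integral_section _ _ _ _ _ _
      (fun zz => (f zz.2)%:E)).
    exact/measurable_EFinP.
  - exact: (@measurable_fun_integral_section _ _ _ _ _ k (EFin \o h)
      (measurable_int _ inth)).
  have := integrable_semiprod_section intaf; apply: filterS => z intz _.
  rewrite /h /g1 /g12/= {1}/Rintegral integral_accept_reject//.
  have mul_a c : (k z).-integrable setT (fun z' => (c * a z z')%:E).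
    by under eq_fun do rewrite EFinM; exact: integrableZl.
  have mul_af c : (k z).-integrable setT (fun z' => (c * (a z z' * f z'))%:E).
    by under eq_fun do rewrite EFinM; exact: integrableZl.
  transitivity (\int[k z]_z' ((f z ^+ 2 * a z z')%:E
      - (f z * (a z z' * f z'))%:E))%E; last first.
    by apply: eq_integral => z' _; rewrite -EFinB; congr EFin; ring.
  rewrite integralB_EFin//; [|exact: mul_a|exact: mul_af].
  under [X in (_ = X - _)%E]eq_integral do rewrite EFinM.
  under [X in (_ = _ - X)%E]eq_integral do rewrite EFinM.
  rewrite !integralZl// rhoE /Rintegral.
  have := integrable_fin_num measurableT (integrable_a z).
  have := integrable_fin_num measurableT intz.
  rewrite /comp; move: (integral _ _ _) (integral _ _ _) => [p| |] [n| |]//= _ _.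
  by rewrite -!EFinM -EFinB; congr EFin; ring.
rewrite fineK; last exact: integrable_fin_num inth.
rewrite -(@ge0_integral_semiprod _ _ _ _ _ k mu (fun zz =>
  (a zz.1 zz.2 * (f zz.1 - f zz.2) ^+ 2)%:E)); last 2 first.
- by move=> zz; rewrite lee_fin mulr_ge0 ?sqr_ge0.
- apply/measurable_EFinP; apply: measurable_funM => //.
  by apply: measurable_funX; exact: measurable_funB.
transitivity (2^-1%:E * \int[N]_zz ((h zz)%:E + (g2 zz - g12 zz)%:E))%E; last first.
  congr (_ * _)%E; apply: eq_integral => zz _; rewrite -EFinD; congr EFin.
  by rewrite /h /g1 /g2 /g12; ring.
have inth' : N.-integrable setT (fun zz => (g2 zz - g12 zz)%:E).
  exact: (integrableB measurableT int2 int12).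
rewrite integralD// /h.
under eq_integral do rewrite EFinB.
under [X in (_ = _ * (_ + X))%E]eq_integral do rewrite EFinB.
rewrite !integralB_EFin// g2E.
have := integrable_fin_num measurableT int1.
have := integrable_fin_num measurableT int12.
rewrite /comp; move: (integral _ _ _) (integral _ _ _) => [p| |] [n| |]//= _ _.
by rewrite -EFinB -EFinD -EFinM; congr EFin; lra.
Qed.

End form.

End accept_reject_dirichlet.

(** * Reparametrized kernels and exchange of integrals *)

Section kernel_comp.
Local Open Scope ereal_scope.
Context d d' d'' (S : measurableType d) (X : measurableType d')
  (Y : measurableType d'') (R : realType).
Variables (k : R.-pker X ~> Y) (phi : S -> X).
Hypothesis mphi : measurable_fun setT phi.

Definition comp_kernel (s : S) : {measure set Y -> \bar R} := k (phi s).

Let measurable_comp_kernel U : measurable U ->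
  measurable_fun [set: S] (comp_kernel ^~ U).
Proof. by move=> mU; exact: (measurableT_comp (measurable_kernel k U mU)). Qed.

HB.instance Definition _ :=
  isKernel.Build _ _ _ _ _ comp_kernel measurable_comp_kernel.

Let comp_kernel_setT s : comp_kernel s setT = 1.
Proof. exact: prob_kernel. Qed.

HB.instance Definition _ :=
  Kernel_isProbability.Build _ _ _ _ _ comp_kernel comp_kernel_setT.

Lemma measurable_fun_integral_comp (f : S -> Y -> \bar R) :
  measurable_fun setT (fun sy : S * Y => f sy.1 sy.2) ->
  measurable_fun setT (fun s => \int[k (phi s)]_y f s y).
Proof.
exact: (@measurable_fun_integral_section _ _ _ _ _ comp_kernel
  (fun sy => f sy.1 sy.2)).
Qed.

End kernel_comp.

Arguments measurable_fun_integral_comp {d d' d'' S X Y R k phi} mphi {f}.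

Section kernel_fubini.
Local Open Scope ereal_scope.
Context d d' (X : measurableType d) (Y : measurableType d') (R : realType).
Variables (k : R.-pker X ~> Y) (x : X).

(** [k x] as a probability measure, so that the theorems on sigma-finite measures
    apply to it. *)
Definition kernel_at : set Y -> \bar R := k x.

HB.instance Definition _ := Measure.on kernel_at.

Let kernel_at_setT : kernel_at setT = 1. Proof. exact: prob_kernel. Qed.

HB.instance Definition _ :=
  Measure_isProbability.Build _ _ _ kernel_at kernel_at_setT.

End kernel_fubini.

Lemma fubini_kernel d d' e e' (X : measurableType d) (Y : measurableType d')
    (X' : measurableType e) (Y' : measurableType e') (R : realType)
    (k : R.-pker X ~> Y) (k' : R.-pker X' ~> Y') x x' (f : Y -> Y' -> \bar R) :
  (forall y y', 0 <= f y y')%E ->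
  measurable_fun setT (fun yy : Y * Y' => f yy.1 yy.2) ->
  (\int[k x]_y \int[k' x']_y' f y y' = \int[k' x']_y' \int[k x]_y f y y')%E.
Proof.
move=> f0 mf.
exact: (fubini_tonelli (m1 := kernel_at k x) (m2 := kernel_at k' x')
  (fun yy => f yy.1 yy.2)).
Qed.

(** * Reversal of the proposal measure *)

Section tierney_swap.
Local Open Scope ereal_scope.
Context d (X : measurableType d) (R : realType).
Variables (pi : probability X R) (q : R.-pker X ~> X) (r : tierneyRatio pi q).

Local Notation fwd := (semiprod pi q).

Let swap (z : X * X) := (z.2, z.1).

Let mswap : measurable_fun setT swap.
Proof. exact: measurable_fun_pair. Qed.

(** The defining property of [r] as a density, for functions instead of sets.  The
    function has to vanish off the Tierney set, because [r] does not see the part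
    of the reversed measure that lives there. *)
Lemma tierney_ratio_swap (g : X * X -> \bar R) :
  (forall z, 0 <= g z) -> measurable_fun setT g ->
  (forall z, ~ tierney_set r z -> g z = 0) ->
  \int[fwd]_z ((r z)%:E * g z) = \int[fwd]_z g (z.2, z.1).
Proof.
move=> g0 mg gR; have mR := measurable_tierney_set r.
have [bwd bwdE] : exists bwd : {measure set (X * X) -> \bar R},
    bwd = pushforward fwd swap :> (set (X * X) -> \bar R).
  (* the witness carries the measurability of the swap *)
  by unshelve eexists (pushforward fwd swap).
pose nu : {measure set (X * X) -> \bar R} := mrestr bwd mR.
transitivity (\int[nu]_z g z).
  apply/esym/(ge0_integral_density (measurable_tierney_ratio r)) => //.
    by move=> z; exact: tierney_ge0.
  move=> A mA; rewrite /nu/= /mrestr bwdE tierney_density//.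
  rewrite integral_mkcondr; apply: eq_integral => z _; rewrite patchE.
  by case: ifPn => // /negP; rewrite inE => /tierney_out ->.
transitivity (\int[bwd]_z g z).
  rewrite (@ge0_integral_density _ _ _ (\1_(tierney_set r)) _ _ bwd)//.
  - apply: eq_integral => z _; rewrite indicE.
    case: (boolP (z \in _)) => [_|]; first by rewrite mul1e.
    by move=> /negP; rewrite inE => /gR ->; rewrite mule0.
  - by move=> A mA; rewrite integral_indic// setIC.
rewrite (eq_measure_integral (pushforward fwd swap)); last first.
  by move=> A _ _; rewrite bwdE.
by rewrite ge0_integral_pushforward.
Qed.

End tierney_swap.

(** * Flows of accepted moves *)

Section flow.
Local Open Scope ereal_scope.
Context d (X : measurableType d) (R : realType).
Variables (pi : probability X R) (q : R.-pker X ~> X) (r : tierneyRatio pi q).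
Variables (W : weightSet R) (Q : weightKernel X W).
Local Notation Z := (X * weights W)%type.
Local Notation fwd := (semiprod pi q).

(** The integrands below depend on the move [((x, w), (y, u))], but are
    integrated over [(x, y)] before [w] and [u]. *)
Lemma measurable_fun_regroup (G : Z -> Z -> \bar R) :
  measurable_fun setT (fun zz : Z * Z => G zz.1 zz.2) ->
  measurable_fun setT (fun p : (X * X) * weights W * weights W =>
    G (p.1.1.1, p.1.2) (p.1.1.2, p.2)).
Proof.
move=> mG.
have m1 : measurable_fun setT
    (fun p : (X * X) * weights W * weights W => p.1.1).
  exact: (measurableT_comp measurable_fst measurable_fst).
have m2 : measurable_fun setT
    (fun p : (X * X) * weights W * weights W => p.1.2).
  exact: (measurableT_comp measurable_snd measurable_fst).
apply: (measurableT_comp mG (g := fun p : (X * X) * weights W * weights W =>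
  ((p.1.1.1, p.1.2), (p.1.1.2, p.2)))).
apply: measurable_fun_pair; apply: measurable_fun_pair => //.
- exact: (measurableT_comp measurable_fst m1).
- exact: (measurableT_comp measurable_snd m1).
Qed.

Section target_proposal.
Variables (K1 K2 : R.-pker X ~> weights W).
Variable F : X * X -> weights W -> weights W -> \bar R.
Hypothesis F_ge0 : forall xy w u, 0 <= F xy w u.
Hypothesis mF : measurable_fun setT
  (fun p : (X * X) * weights W * weights W => F p.1.1 p.1.2 p.2).

Let mF2 : measurable_fun setT
  (fun p : (X * X) * weights W => \int[K2 p.1.2]_u F p.1 p.2 u).
Proof.
apply: (measurable_fun_integral_comp (phi := fun p => p.1.2)) => //.
exact: (measurableT_comp measurable_snd measurable_fst).
Qed.

Lemma measurable_fun_weight_integral : measurable_fun setT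
  (fun xy => \int[K1 xy.1]_w \int[K2 xy.2]_u F xy w u).
Proof. exact: (measurable_fun_integral_comp (phi := fst)). Qed.

(** A target of the form [pi(dx) K1_x(dw)] followed by the proposal
    [q(x, dy) K2_y(du)] draws [w] before [y]; they are independent given [x], so
    [y] may be drawn first. *)
Lemma integral_target_proposal :
  \int[semiprod pi K1]_z \int[proposal q K2 z]_z' F (z.1, z'.1) z.2 z'.2 =
  \int[fwd]_xy \int[K1 xy.1]_w \int[K2 xy.2]_u F xy w u.
Proof.
have mF' : measurable_fun setT
    (fun zz : Z * Z => F (zz.1.1, zz.2.1) zz.1.2 zz.2.2).
  apply: (measurableT_comp mF (g := fun zz : Z * Z =>
    ((zz.1.1, zz.2.1), zz.1.2, zz.2.2))).
  by do !apply: measurable_fun_pair; exact: measurableT_comp.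
rewrite ge0_integral_semiprod//; last 2 first.
- by move=> z; exact: integral_ge0.
- exact: (@measurable_fun_integral_section _ _ _ _ _ (proposal q K2)
    (fun zz => F (zz.1.1, zz.2.1) zz.1.2 zz.2.2)).
rewrite ge0_integral_semiprod//; last 2 first.
- by move=> xy; apply: integral_ge0 => w _; exact: integral_ge0.
- exact: measurable_fun_weight_integral.
apply: eq_integral => x _ /=.
rewrite -(fubini_kernel K1 q x x (f := fun w y => \int[K2 y]_u F (x, y) w u)).
- apply: eq_integral => w _; rewrite /proposal/= ge0_integral_semiprod//.
  apply: (measurableT_comp mF (g := fun z : Z => ((x, z.1), w, z.2))).
  by do !apply: measurable_fun_pair.
- by move=> w y; exact: integral_ge0.
- apply: (measurableT_comp mF2
    (g := fun wy : weights W * X => ((x, wy.2), wy.1))).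
  by do !apply: measurable_fun_pair.
Qed.

End target_proposal.

Lemma ge0_integral_sized x (g : weights W -> \bar R) :
  (forall w, 0 <= g w) -> measurable_fun setT g ->
  \int[sized_kernel Q x]_w g w = \int[Q x]_w ((wval w)%:E * g w).
Proof.
move=> g0 mg.
exact: (ge0_integral_density (measurable_wval (W := W)) (@wval_ge0 _ W)).
Qed.

(** The function [b t w u] is the density of the accepted moves from [(x, w)] to
    [(y, u)] relative to [pi(dx) q(x, dy) Q_x(dw) Q_y(du)], with [t] the ratio at
    [(x, y)]. *)
Definition flow (b : R -> R -> R -> R) (G : Z -> Z -> \bar R) : \bar R :=
  \int[fwd]_xy \int[Q xy.1]_w \int[Q xy.2]_u
    ((b (r xy) (wval w) (wval u))%:E * G (xy.1, w) (xy.2, u)).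

Section weight.
Variable b : R -> R -> R -> R.
Hypothesis mb : measurable_fun setT (fun p : R * R * R => b p.1.1 p.1.2 p.2).
Hypothesis b_ge0 : forall t w u,
  (0 <= t -> 0 <= w -> 0 <= u -> 0 <= b t w u)%R.

Section test_function.
Variable G : Z -> Z -> \bar R.
Hypothesis G_ge0 : forall z z', 0 <= G z z'.
Hypothesis mG : measurable_fun setT (fun zz : Z * Z => G zz.1 zz.2).

Let F (xy : X * X) w u :=
  (b (r xy) (wval w) (wval u))%:E * G (xy.1, w) (xy.2, u).

Lemma flow_integrand_ge0 xy w u : 0 <= F xy w u.
Proof.
by rewrite mule_ge0// lee_fin b_ge0 ?wval_ge0 ?tierney_ge0.
Qed.

Lemma measurable_flow_integrand : measurable_fun setT
  (fun p : (X * X) * weights W * weights W => F p.1.1 p.1.2 p.2).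
Proof.
have m1 : measurable_fun setT
    (fun p : (X * X) * weights W * weights W => p.1.1).
  exact: (measurableT_comp measurable_fst measurable_fst).
have m2 : measurable_fun setT
    (fun p : (X * X) * weights W * weights W => p.1.2).
  exact: (measurableT_comp measurable_snd measurable_fst).
apply: emeasurable_funM.
  apply/measurable_EFinP; apply: (measurableT_comp mb
    (g := fun p : (X * X) * weights W * weights W =>
      (r p.1.1, wval p.1.2, wval p.2))).
  apply: measurable_fun_pair; last exact: (measurableT_comp measurable_wval).
  apply: measurable_fun_pair; last exact: (measurableT_comp measurable_wval).
  exact: (measurableT_comp (measurable_tierney_ratio r)).
exact: measurable_fun_regroup.
Qed.

Lemma measurable_flow_inner xy w : measurable_fun setT (F xy w).
Proof.
exact: (measurableT_comp measurable_flow_integrand (measurable_pair1 (xy, w))).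
Qed.

Lemma measurable_flow_pair xy :
  measurable_fun setT (fun wu : weights W * weights W => F xy wu.1 wu.2).
Proof.
apply: (measurableT_comp measurable_flow_integrand
  (g := fun wu : weights W * weights W => (xy, wu.1, wu.2))).
by do !apply: measurable_fun_pair.
Qed.

Lemma measurable_flow_middle xy :
  measurable_fun setT (fun w => \int[Q xy.2]_u F xy w u).
Proof.
apply: (measurable_fun_integral_comp (phi := fun=> xy.2)) => //.
exact: measurable_flow_pair.
Qed.

Lemma measurable_flow_outer : measurable_fun setT
  (fun xy => \int[Q xy.1]_w \int[Q xy.2]_u F xy w u).
Proof.
exact: (measurable_fun_weight_integral Q Q measurable_flow_integrand).
Qed.

End test_function.

Hypothesis b0 : forall w u, (0 <= w -> 0 <= u -> b 0 w u = 0)%R.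

Hypothesis b_inv : forall t w u,
  (0 < t -> 0 <= w -> 0 <= u -> b t w u = t * b t^-1 u w)%R.

(** Detailed balance.  The factor [t] in [b_inv] turns the forward proposal measure
    into the reversed one, for which the ratio is [1 / t]; renaming [x] and [y]
    then gives back the same flow with the end points exchanged. *)
Lemma flow_sym (G : Z -> Z -> \bar R) :
  (forall z z', 0 <= G z z') ->
  measurable_fun setT (fun zz : Z * Z => G zz.1 zz.2) ->
  flow b G = flow b (fun z z' => G z' z).
Proof.
move=> G0 mG; pose G' z z' := G z' z.
have mG' : measurable_fun setT (fun zz : Z * Z => G' zz.1 zz.2).
  apply: (measurableT_comp mG (g := fun zz : Z * Z => (zz.2, zz.1))).
  exact: measurable_fun_pair.
(* the integrand of the reversed move, as a function of the forward one *)
pose F' (xy : X * X) w u :=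
  (b (r (xy.2, xy.1)) (wval u) (wval w))%:E * G (xy.1, w) (xy.2, u).
have F'0 xy w u : 0 <= F' xy w u.
  by apply: (flow_integrand_ge0 (G := G') _ (xy.2, xy.1) u w) => z z';
    exact: G0.
have mF' : measurable_fun setT
    (fun p : (X * X) * weights W * weights W => F' p.1.1 p.1.2 p.2).
  have m1 : measurable_fun setT
      (fun p : (X * X) * weights W * weights W => p.1.1).
    exact: (measurableT_comp measurable_fst measurable_fst).
  have m2 : measurable_fun setT
      (fun p : (X * X) * weights W * weights W => p.1.2).
    exact: (measurableT_comp measurable_snd measurable_fst).
  apply: (measurableT_comp (measurable_flow_integrand mG')
    (g := fun p => ((p.1.1.2, p.1.1.1), p.2, p.1.2))).
  apply: measurable_fun_pair => //; apply: measurable_fun_pair => //.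
  by apply: measurable_fun_pair; exact: measurableT_comp.
have mF'pair xy :
    measurable_fun setT (fun wu : weights W * weights W => F' xy wu.1 wu.2).
  apply: (measurableT_comp mF' (g := fun wu => (xy, wu.1, wu.2))).
  by do !apply: measurable_fun_pair.
transitivity (\int[fwd]_xy ((r xy)%:E *
    \int[Q xy.1]_w \int[Q xy.2]_u F' xy w u)).
  apply: eq_integral => -[x y] _ /=.
  have [Rxy|/tierney_out rxy0] := pselect (tierney_set r (x, y)); last first.
    rewrite rxy0 mul0e integral0_eq// => w _; rewrite integral0_eq// => u _.
    by rewrite b0 ?wval_ge0// mul0e.
  have r0 := tierney_gt0 Rxy.
  have rV : r (y, x) = (r (x, y))^-1%R.
    by apply: (mulfI (lt0r_neq0 r0)); rewrite tierney_inv// divff// lt0r_neq0.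
  rewrite -ge0_integralZl//; last 3 first.
  - exact: (measurable_fun_integral_comp (phi := fun=> y)).
  - by move=> w _; exact: integral_ge0.
  - by rewrite lee_fin ltW.
  apply: eq_integral => w _; rewrite -ge0_integralZl//; last 2 first.
  - exact: (measurableT_comp (mF'pair (x, y)) (measurable_pair1 w)).
  - by rewrite lee_fin ltW.
  apply: eq_integral => u _.
  by rewrite /F' muleA -EFinM rV -b_inv ?wval_ge0.
rewrite (tierney_ratio_swap (r := r)
    (g := fun xy => \int[Q xy.1]_w \int[Q xy.2]_u F' xy w u)).
- apply: eq_integral => -[x y] _ /=.
  exact: (fubini_kernel Q Q y x (f := F' (y, x))).
- by move=> xy; apply: integral_ge0 => w _; exact: integral_ge0.
- exact: (measurable_fun_weight_integral Q Q mF').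
- move=> [x y] nR; have /tierney_out ryx0 : ~ tierney_set r (y, x).
    by move=> /tierney_set_sym.
  rewrite integral0_eq// => w _; rewrite integral0_eq// => u _.
  by rewrite /F'/= ryx0 b0 ?wval_ge0// mul0e.
Qed.

Lemma flowZ c (G : Z -> Z -> \bar R) : (0 <= c)%R ->
  (forall z z', 0 <= G z z') ->
  measurable_fun setT (fun zz : Z * Z => G zz.1 zz.2) ->
  flow (fun t w u => c * b t w u)%R G = c%:E * flow b G.
Proof.
move=> c0 G0 mG; rewrite /flow -ge0_integralZl//; last 2 first.
- exact: measurable_flow_outer.
- by move=> xy _; apply: integral_ge0 => w _; apply: integral_ge0 => u _;
    exact: flow_integrand_ge0.
apply: eq_integral => xy _; rewrite -ge0_integralZl//; last 2 first.
- exact: measurable_flow_middle.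
- by move=> w _; apply: integral_ge0 => u _; exact: flow_integrand_ge0.
apply: eq_integral => w _; rewrite -ge0_integralZl//.
- by apply: eq_integral => u _; rewrite EFinM muleA.
- exact: measurable_flow_inner.
- by move=> u _; exact: flow_integrand_ge0.
Qed.

End weight.

End flow.

(** * Comparison of flows under a bound on the weights *)

Section flow_le.
Local Open Scope ereal_scope.
Context d (X : measurableType d) (R : realType).
Variables (pi : probability X R) (q : R.-pker X ~> X) (r : tierneyRatio pi q).
Variables (W : weightSet R) (Q : weightKernel X W).
Local Notation Z := (X * weights W)%type.
Local Notation fwd := (semiprod pi q).

(** The restriction to the Tierney set is essential for the second weight: on that
    set, the law of [y] is dominated by its law under the reversed measure, which
    is [pi]. *)
Lemma ae_flow_weight_le (wbar : R) : {ae pi, forall x,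
    Q x [set w | wval w \in `[0, wbar]%R] = 1} ->
  {ae fwd, forall xy, tierney_set r xy ->
    {ae Q xy.1, forall w, (wval w <= wbar)%R} /\
    {ae Q xy.2, forall w, (wval w <= wbar)%R}}.
Proof.
move=> [N [mN piN0 subN]].
have good x : ~ N x -> {ae Q x, forall w, (wval w <= wbar)%R}.
  move=> Nx; pose B : set (weights W) := [set w | wval w \in `[0, wbar]%R].
  have mB : measurable B.
    have := measurable_wval (W := W) measurableT _ (measurable_itv `[0%R, wbar]).
    by rewrite setTI.
  have QB : Q x B = 1 by apply: contrapT => QB; exact/Nx/subN.
  exists (~` B); split; first exact: measurableC.
    have := probability_setC (kernel_at Q x) mB.
    by rewrite {2}/kernel_at QB subee.
  by move=> w /= wB; contradict wB; move: wB; rewrite /B/= in_itv/= => /andP[].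
have mR := measurable_tierney_set r.
have mN1 : measurable (N `*` [set: X]) by exact: measurableX.
have mN2 : measurable ([set: X] `*` N) by exact: measurableX.
have fwdN : fwd (N `*` setT) = 0.
  rewrite /semiprod (eq_integral (fun x => (\1_N x)%:E)).
    by rewrite integral_indic// setIT.
  move=> x _; rewrite indicE; case: (boolP (x \in N)) => xN.
    rewrite (_ : xsection _ _ = setT) ?prob_kernel//.
    apply/seteqP; split => // y _.
    by rewrite /xsection/= inE; split => //; exact/set_mem.
  rewrite (_ : xsection _ _ = set0) ?measure0//.
  apply/seteqP; split => // y; rewrite /xsection/= inE => -[/mem_set].
  by rewrite (negbTE xN).
have fwdNR : fwd (([set: X] `*` N) `&` tierney_set r) = 0.
  (* the reversed measure of X * N is the forward measure of N * X *)
  apply: (@tierney_fwd_bwd _ _ _ _ _ r ([set: X] `*` N)) => // B mB BN.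
  have mswap : measurable_fun setT (fun z : X * X => (z.2, z.1)).
    exact: measurable_fun_pair.
  apply: (subset_measure0 _ mN1 _ fwdN).
    by rewrite -[X in measurable X]setTI; apply: mswap => //; exact: measurableI.
  by move=> [x y] /= [/BN[_ Nx] _].
exists ((N `*` setT) `|` (([set: X] `*` N) `&` tierney_set r)); split.
- by apply: measurableU => //; exact: measurableI.
- by rewrite measureU0//; exact: measurableI.
move=> -[x y] /= /not_implyP[Rxy nxy]; apply: contrapT => /not_orP[N1 N2].
apply: nxy; split; apply: good => Nxy; [exact: N1|exact: N2].
Qed.

(** The densities need to be compared only for weights at most [wbar]; [b1] has to
    vanish at ratio [0], since nothing bounds the weight of the proposed point
    there. *)
Lemma flow_le (wbar : R) (b1 b2 : R -> R -> R -> R) (G : Z -> Z -> \bar R) :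
  measurable_fun setT (fun p : R * R * R => b1 p.1.1 p.1.2 p.2) ->
  measurable_fun setT (fun p : R * R * R => b2 p.1.1 p.1.2 p.2) ->
  (forall t w u, (0 <= t -> 0 <= w -> 0 <= u -> 0 <= b1 t w u)%R) ->
  (forall t w u, (0 <= t -> 0 <= w -> 0 <= u -> 0 <= b2 t w u)%R) ->
  (forall w u, (0 <= w -> 0 <= u -> b1 0 w u = 0)%R) ->
  (forall t w u, (0 <= t -> 0 <= w <= wbar -> 0 <= u <= wbar ->
    b1 t w u <= b2 t w u)%R) ->
  {ae pi, forall x, Q x [set w | wval w \in `[0, wbar]%R] = 1} ->
  (forall z z', 0 <= G z z') ->
  measurable_fun setT (fun zz : Z * Z => G zz.1 zz.2) ->
  flow r Q b1 G <= flow r Q b2 G.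
Proof.
move=> mb1 mb2 b1_ge0 b2_ge0 b10 b12 Qw G0 mG.
apply: ae_ge0_le_integral => //.
- by move=> xy _; apply: integral_ge0 => w _; apply: integral_ge0 => u _;
    exact: flow_integrand_ge0.
- exact: measurable_flow_outer.
- by move=> xy _; apply: integral_ge0 => w _; apply: integral_ge0 => u _;
    exact: flow_integrand_ge0.
- exact: measurable_flow_outer.
have := ae_flow_weight_le Qw; apply: filterS => xy Rxy _.
have [/Rxy[aew aeu]|/tierney_out rxy0] := pselect (tierney_set r xy); last first.
  rewrite integral0_eq => [|w _].
    by apply: integral_ge0 => w _; apply: integral_ge0 => u _;
      exact: flow_integrand_ge0.
  by rewrite integral0_eq// => u _; rewrite rxy0 b10 ?wval_ge0// mul0e.
apply: ae_ge0_le_integral => //.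
- by move=> w _; apply: integral_ge0 => u _; exact: flow_integrand_ge0.
- exact: measurable_flow_middle.
- by move=> w _; apply: integral_ge0 => u _; exact: flow_integrand_ge0.
- exact: measurable_flow_middle.
move: aew; apply: filterS => w w_le _.
apply: ae_ge0_le_integral => //.
- by move=> u _; exact: flow_integrand_ge0.
- exact: measurable_flow_inner.
- by move=> u _; exact: flow_integrand_ge0.
- exact: measurable_flow_inner.
move: aeu; apply: filterS => u u_le _.
by rewrite lee_wpmul2r// lee_fin b12 ?tierney_ge0 ?wval_ge0.
Qed.

End flow_le.

(** * The two acceptance densities *)

Section comparison.
Context d (X : measurableType d) (R : realType).
Variables (pi : probability X R) (q : R.-pker X ~> X) (r : tierneyRatio pi q).
Variables (W : weightSet R) (Q : weightKernel X W).
Local Notation Z := (X * weights W)%type.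
Local Notation mu := (pm_target pi Q).

Definition pm_weight (t w u : R) : R := Num.min w (t * u).

Definition aux_weight (t w u : R) : R := w * u * Num.min 1 t.

Lemma pm_weight_ge0 t w u : 0 <= t -> 0 <= w -> 0 <= u -> 0 <= pm_weight t w u.
Proof. by move=> t0 w0 u0; rewrite le_min w0 mulr_ge0. Qed.

Lemma aux_weight_ge0 t w u :
  0 <= t -> 0 <= w -> 0 <= u -> 0 <= aux_weight t w u.
Proof. by move=> t0 w0 u0; rewrite !mulr_ge0// le_min ler01. Qed.

Lemma pm_weight0 w u : 0 <= w -> 0 <= u -> pm_weight 0 w u = 0.
Proof. by move=> w0 u0; rewrite /pm_weight mul0r min_r. Qed.

Lemma aux_weight0 w u : 0 <= w -> 0 <= u -> aux_weight 0 w u = 0.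
Proof. by move=> w0 u0; rewrite /aux_weight min_r ?ler01// mulr0. Qed.

Lemma pm_weight_inv t w u : 0 < t -> 0 <= w -> 0 <= u ->
  pm_weight t w u = t * pm_weight t^-1 u w.
Proof.
move=> t0 w0 u0; rewrite /pm_weight minr_pMr ?ltW// mulVKf ?gt_eqF//.
by rewrite minC.
Qed.

Lemma aux_weight_inv t w u : 0 < t -> 0 <= w -> 0 <= u ->
  aux_weight t w u = t * aux_weight t^-1 u w.
Proof.
move=> t0 w0 u0; rewrite /aux_weight.
have -> : Num.min 1 t = t * Num.min 1 t^-1.
  by rewrite minr_pMr ?ltW// mulr1 mulfV ?gt_eqF// minC.
by ring.
Qed.

Lemma measurable_pm_weight :
  measurable_fun setT (fun p : R * R * R => pm_weight p.1.1 p.1.2 p.2).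
Proof.
apply: measurable_minr; first exact: (measurableT_comp measurable_snd).
by apply: measurable_funM => //; exact: (measurableT_comp measurable_fst).
Qed.

Lemma measurable_aux_weight :
  measurable_fun setT (fun p : R * R * R => aux_weight p.1.1 p.1.2 p.2).
Proof.
apply: measurable_funM.
  by apply: measurable_funM => //; exact: (measurableT_comp measurable_snd).
by apply: measurable_minr => //; exact: (measurableT_comp measurable_fst).
Qed.

(** In [w * u * min 1 t], the bound [u <= wbar] gives the first argument of
    [min w (t * u)] and the bound [w <= wbar] gives the second. *)
Lemma aux_weight_le wbar t w u : 1 <= wbar -> 0 <= t ->
  0 <= w <= wbar -> 0 <= u <= wbar ->
  wbar^-1 * aux_weight t w u <= pm_weight t w u.
Proof.
move=> wbar1 t0 /andP[w0 ww] /andP[u0 uw].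
have wbar0 : 0 < wbar by exact: lt_le_trans wbar1.
rewrite /aux_weight /pm_weight ler_pdivrMl//.
have [_|_] := leP w (t * u).
  apply: (@le_trans _ _ (w * u)); last by rewrite mulrC ler_wpM2r.
  by rewrite ler_piMr ?mulr_ge0// ge_min lexx.
apply: (@le_trans _ _ (w * u * t)).
  by rewrite ler_wpM2l ?mulr_ge0// ge_min lexx orbT.
by rewrite -mulrA (mulrC u) ler_wpM2r ?mulr_ge0.
Qed.

Lemma measurable_ratio_pair :
  measurable_fun setT (fun zz : Z * Z => r (zz.1.1, zz.2.1)).
Proof.
apply: measurableT_comp; first exact: measurable_tierney_ratio.
by apply: measurable_fun_pair; exact: measurableT_comp.
Qed.

Lemma measurable_pm_accept :
  measurable_fun setT (fun zz : Z * Z => pm_accept r zz.1 zz.2).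
Proof.
have mw1 : measurable_fun setT (fun zz : Z * Z => wval zz.1.2).
  exact: (measurableT_comp measurable_wval
    (measurableT_comp measurable_snd measurable_fst)).
have mw2 : measurable_fun setT (fun zz : Z * Z => wval zz.2.2).
  exact: (measurableT_comp measurable_wval
    (measurableT_comp measurable_snd measurable_snd)).
apply: measurable_fun_ifT => //; first exact: measurable_fun_eqr.
apply: measurable_minr => //; apply: measurable_funM.
  exact: measurable_ratio_pair.
apply: measurable_funM => //.
(* inversion is measurable on the nonnegative reals as a real power *)
under eq_fun do rewrite -(powR_inv1 (wval_ge0 _)).
exact: (measurableT_comp (measurable_powR _)).
Qed.

Lemma measurable_mh_accept :
  measurable_fun setT (fun zz : Z * Z => mh_accept r zz.1.1 zz.2.1).
Proof. by apply: measurable_minr => //; exact: measurable_ratio_pair. Qed.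

Lemma pm_accept_ge0 (z z' : Z) : 0 <= pm_accept r z z'.
Proof.
rewrite /pm_accept; case: ifPn => // _.
by rewrite le_min ler01/= mulr_ge0 ?tierney_ge0// divr_ge0 ?wval_ge0.
Qed.

Lemma pm_accept_le1 (z z' : Z) : pm_accept r z z' <= 1.
Proof. by rewrite /pm_accept; case: ifPn => // _; rewrite ge_min lexx. Qed.

Lemma mh_accept_ge0 x y : 0 <= mh_accept r x y.
Proof. by rewrite le_min ler01/= tierney_ge0. Qed.

Lemma mh_accept_le1 x y : mh_accept r x y <= 1.
Proof. by rewrite ge_min lexx. Qed.

(** The factor [wval w] is the density of the weight under the target; it clears
    the denominator of [u / w], and both sides vanish at [w = 0]. *)
Lemma pm_acceptE x y (w u : weights W) :
  wval w * pm_accept r (x, w) (y, u) = pm_weight (r (x, y)) (wval w) (wval u).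
Proof.
rewrite /pm_accept/= /pm_weight; case: eqP => [->|/eqP w_neq0].
  by rewrite mul0r min_l// mulr_ge0 ?tierney_ge0 ?wval_ge0.
rewrite minr_pMr ?wval_ge0// mulr1 mulrCA; congr (Num.min _ (_ * _)).
by rewrite mulrC divfK.
Qed.

Section test_function.
Local Open Scope ereal_scope.
Variable G : Z -> Z -> \bar R.
Hypothesis G_ge0 : forall z z', 0 <= G z z'.
Hypothesis mG : measurable_fun setT (fun zz : Z * Z => G zz.1 zz.2).

Lemma pm_flowE :
  \int[mu]_z \int[proposal q Q z]_z' ((pm_accept r z z')%:E * G z z') =
  flow r Q pm_weight G.
Proof.
pose F (xy : X * X) w u :=
  (pm_accept r (xy.1, w) (xy.2, u))%:E * G (xy.1, w) (xy.2, u).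
have F_ge0 xy w u : 0 <= F xy w u by rewrite mule_ge0// lee_fin pm_accept_ge0.
have mF : measurable_fun setT
    (fun p : (X * X) * weights W * weights W => F p.1.1 p.1.2 p.2).
  apply: (measurable_fun_regroup
    (G := fun z z' => (pm_accept r z z')%:E * G z z')).
  apply: emeasurable_funM => //; apply/measurable_EFinP.
  exact: measurable_pm_accept.
have mFpair xy :
    measurable_fun setT (fun wu : weights W * weights W => F xy wu.1 wu.2).
  apply: (measurableT_comp mF (g := fun wu => (xy, wu.1, wu.2))).
  by do !apply: measurable_fun_pair.
transitivity (\int[semiprod pi (sized_kernel Q)]_z
    \int[proposal q Q z]_z' F (z.1, z'.1) z.2 z'.2).
  by apply: eq_integral => -[x w] _; apply: eq_integral => -[y u] _.
apply: (etrans (integral_target_proposal pi q (sized_kernel Q) Q F_ge0 mF)).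
apply: eq_integral => -[x y] _ /=.
rewrite ge0_integral_sized//; last 2 first.
- by move=> w; exact: integral_ge0.
- exact: (measurable_fun_integral_comp (phi := fun=> y)).
apply: eq_integral => w _; rewrite -ge0_integralZl//; last 2 first.
- exact: (measurableT_comp (mFpair (x, y)) (measurable_pair1 w)).
- by rewrite lee_fin wval_ge0.
by apply: eq_integral => u _; rewrite muleA -EFinM pm_acceptE.
Qed.

Lemma aux_flowE :
  \int[mu]_z \int[proposal q (sized_kernel Q) z]_z'
    ((mh_accept r z.1 z'.1)%:E * G z z') =
  flow r Q aux_weight G.
Proof.
pose F (xy : X * X) w u :=
  (mh_accept r xy.1 xy.2)%:E * G (xy.1, w) (xy.2, u).
have F_ge0 xy w u : 0 <= F xy w u by rewrite mule_ge0// lee_fin mh_accept_ge0.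
have mF : measurable_fun setT
    (fun p : (X * X) * weights W * weights W => F p.1.1 p.1.2 p.2).
  apply: (measurable_fun_regroup
    (G := fun z z' => (mh_accept r z.1 z'.1)%:E * G z z')).
  apply: emeasurable_funM => //; apply/measurable_EFinP.
  exact: measurable_mh_accept.
have mFpair xy :
    measurable_fun setT (fun wu : weights W * weights W => F xy wu.1 wu.2).
  apply: (measurableT_comp mF (g := fun wu => (xy, wu.1, wu.2))).
  by do !apply: measurable_fun_pair.
have mFw xy w : measurable_fun setT (F xy w).
  exact: (measurableT_comp (mFpair xy) (measurable_pair1 w)).
transitivity (\int[semiprod pi (sized_kernel Q)]_z
    \int[proposal q (sized_kernel Q) z]_z' F (z.1, z'.1) z.2 z'.2).
  by apply: eq_integral => -[x w] _; apply: eq_integral => -[y u] _.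
apply: (etrans (integral_target_proposal pi q _ (sized_kernel Q) F_ge0 mF)).
apply: eq_integral => xy _.
rewrite ge0_integral_sized//; last 2 first.
- by move=> w; exact: integral_ge0.
- exact: (measurable_fun_integral_comp (k := sized_kernel Q)
    (phi := fun=> xy.2) (f := F xy) (measurable_cst xy.2) (mFpair xy)).
apply: eq_integral => w _; rewrite ge0_integral_sized// -ge0_integralZl//;
  last 3 first.
- apply: emeasurable_funM => //.
  by apply/measurable_EFinP; exact: measurable_wval.
- by move=> u _; rewrite mule_ge0// lee_fin wval_ge0.
- by rewrite lee_fin wval_ge0.
by apply: eq_integral => u _; rewrite /F !muleA -!EFinM; case: xy.
Qed.

End test_function.

Let measurable_sqr_diff (f : Z -> R) : measurable_fun setT f ->
  measurable_fun setT (fun zz : Z * Z => ((f zz.1 - f zz.2) ^+ 2)%:E).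
Proof.
move=> mf; apply/measurable_EFinP; apply: measurable_funX.
apply: measurable_funB.
  exact: (measurableT_comp mf measurable_fst).
exact: (measurableT_comp mf measurable_snd).
Qed.

(** The symmetry of the density [b] supplies the balance of marginals on which
    the quadratic expression of the Dirichlet form rests. *)
Lemma dirichlet_flowE (k P : R.-pker Z ~> Z) (a : Z -> Z -> R) (rho : Z -> R)
    (b : R -> R -> R -> R) (f : Z -> R) :
  measurable_fun setT (fun zz : Z * Z => a zz.1 zz.2) ->
  (forall z z', 0 <= a z z') -> (forall z z', a z z' <= 1) ->
  (forall z A, P z A = accept_reject k a rho z A) ->
  measurable_fun setT (fun p : R * R * R => b p.1.1 p.1.2 p.2) ->
  (forall t w u, 0 <= t -> 0 <= w -> 0 <= u -> 0 <= b t w u) ->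
  (forall w u, 0 <= w -> 0 <= u -> b 0 w u = 0) ->
  (forall t w u, 0 < t -> 0 <= w -> 0 <= u ->
    b t w u = t * b t^-1 u w) ->
  (forall G : Z -> Z -> \bar R, (forall z z', 0 <= G z z')%E ->
    measurable_fun setT (fun zz : Z * Z => G zz.1 zz.2) ->
    (\int[mu]_z \int[k z]_z' ((a z z')%:E * G z z') = flow r Q b G)%E) ->
  square_integrable mu f ->
  ((dirichlet mu P f)%:E =
   2^-1%:E * flow r Q b (fun z z' => ((f z - f z') ^+ 2)%:E))%E.
Proof.
move=> ma a_ge0 a_le1 PE mb b_ge0 b0 b_inv flowE f2.
have mf : measurable_fun setT f by case: f2.
rewrite (dirichlet_accept_rejectE ma a_ge0 a_le1 PE _ f2).
  rewrite -flowE; first by under eq_integral do under eq_integral do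
    rewrite EFinM.
  - by move=> z z'; rewrite lee_fin sqr_ge0.
  - exact: measurable_sqr_diff.
move=> phi phi_ge0 mphi.
have m1 := measurableT_comp mphi (@measurable_fst _ _ Z Z).
have m2 := measurableT_comp mphi (@measurable_snd _ _ Z Z).
apply: (etrans (flowE (fun _ z' => phi z') (fun _ => phi_ge0) m2)).
apply: (etrans (flow_sym r Q mb b_ge0 b0 b_inv (G := fun _ z' => phi z')
  (fun _ => phi_ge0) m2)).
exact: (esym (flowE (fun z _ => phi z) (fun z _ => phi_ge0 z) m1)).
Qed.

Lemma pm_dirichletE f : square_integrable mu f ->
  ((dirichlet mu (pseudo_marginal r Q) f)%:E =
   2^-1%:E * flow r Q pm_weight (fun z z' => ((f z - f z') ^+ 2)%:E))%E.
Proof.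
have PE z A : pseudo_marginal r Q z A =
    accept_reject (proposal q Q) (pm_accept r (W:=W)) (pm_reject r Q) z A by [].
exact: (dirichlet_flowE measurable_pm_accept pm_accept_ge0 pm_accept_le1 PE
  measurable_pm_weight pm_weight_ge0 pm_weight0 pm_weight_inv pm_flowE).
Qed.

Lemma aux_dirichletE f : square_integrable mu f ->
  ((dirichlet mu (auxiliary r Q) f)%:E =
   2^-1%:E * flow r Q aux_weight (fun z z' => ((f z - f z') ^+ 2)%:E))%E.
Proof.
pose a (z z' : Z) := mh_accept r z.1 z'.1.
have PE z A : auxiliary r Q z A = accept_reject
    (proposal q (sized_kernel Q)) a (fun z : Z => mh_reject r z.1) z A by [].
exact: (dirichlet_flowE (a := a) measurable_mh_accept
  (fun z z' => mh_accept_ge0 z.1 z'.1) (fun z z' => mh_accept_le1 z.1 z'.1) PE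
  measurable_aux_weight aux_weight_ge0 aux_weight0 aux_weight_inv aux_flowE).
Qed.

Lemma dirichlet_le (wbar : R) f : 1 <= wbar ->
  {ae pi, forall x, Q x [set w | wval w \in `[0, wbar]] = 1%E} ->
  square_integrable mu f ->
  wbar^-1 * dirichlet mu (auxiliary r Q) f
    <= dirichlet mu (pseudo_marginal r Q) f.
Proof.
move=> wbar1 Qw f2.
(* Da and Dp hide the two kernels, whose unfolding is costly *)
suff forms_le (Da Dp : R) :
    (Da%:E = 2^-1%:E *
      flow r Q aux_weight (fun z z' => ((f z - f z') ^+ 2)%:E))%E ->
    (Dp%:E = 2^-1%:E *
      flow r Q pm_weight (fun z z' => ((f z - f z') ^+ 2)%:E))%E ->
    wbar^-1 * Da <= Dp.
  exact: (forms_le _ _ (aux_dirichletE f2) (pm_dirichletE f2)).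
move=> DaE DpE; rewrite -lee_fin EFinM DaE DpE.
have mf : measurable_fun setT f by case: f2.
have sq_ge0 (z z' : Z) : (0 <= ((f z - f z') ^+ 2)%:E)%E.
  by rewrite lee_fin sqr_ge0.
have msq := measurable_sqr_diff mf.
have wbarV_ge0 : 0 <= wbar^-1 by rewrite invr_ge0 (le_trans ler01).
rewrite muleCA; apply: lee_wpmul2l; first by rewrite lee_fin.
rewrite -(flowZ r Q measurable_aux_weight aux_weight_ge0 wbarV_ge0 sq_ge0 msq).
apply: (@flow_le _ _ _ _ _ r _ Q wbar _ _ _ _ _ _ _ _ _ Qw sq_ge0 msq).
- by apply: measurable_funM => //; exact: measurable_aux_weight.
- exact: measurable_pm_weight.
- by move=> t w u t0 w0 u0; rewrite mulr_ge0 ?aux_weight_ge0.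
- exact: pm_weight_ge0.
- by move=> w u w0 u0; rewrite aux_weight0// mulr0.
- by move=> t w u; exact: aux_weight_le.
Qed.

End comparison.

Theorem proposition10 (R : realType) (d : measure_display)
    (X : measurableType d) (pi : probability X R) (q : R.-pker X ~> X)
    (r : tierneyRatio pi q) (W : weightSet R) (Q : weightKernel X W)
    (wbar : R) (wbar_ge1 : 1 <= wbar)
    (Q_wbar : {ae pi, forall x,
      Q x [set w | wval w \in `[0, wbar]] = 1%E}) :
  (forall f : X * weights W -> R, square_integrable (pm_target pi Q) f ->
    wbar^-1 * dirichlet (pm_target pi Q) (auxiliary r Q) f
      <= dirichlet (pm_target pi Q) (pseudo_marginal r Q) f) /\
  (wbar^-1%:E * gap (pm_target pi Q) (auxiliary r Q)
     <= gap (pm_target pi Q) (pseudo_marginal r Q))%E.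
Proof.
split=> [f f2|]; first exact: dirichlet_le.
apply/ereal_infP => _ [g [g2 Vg] <-].
apply: (@le_trans _ _ (wbar^-1%:E *
    (dirichlet (pm_target pi Q) (auxiliary r Q) g /
     fine 'V_(pm_target pi Q)[g])%:E)%E).
  apply: lee_wpmul2l; first by rewrite lee_fin invr_ge0 (le_trans ler01).
  by apply: ereal_inf_lbound; exists g.
rewrite -EFinM lee_fin mulrA; apply: ler_wpM2r; last exact: dirichlet_le.
by rewrite invr_ge0; apply: fine_ge0; exact: ltW.
Qed.
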